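(* In the ring of fractions of $\mathrm{M}_{p,u}(n)$ one has $${\det}_q(T)=|T|_{11}\,|T^{11}|_{22}\,|T^{12,12}|_{33}\cdots t_{nn},$$ and the quasi-minors on the right-hand side commute with each other. More generally, for two permutations $\sigma,\tau\in S_n$, $${\det}_q(T)=\frac{(-q)_\tau}{(-q)_\sigma}\,|T|_{\sigma_1\tau_1}\,|T^{\sigma_1,\tau_1}|_{\sigma_2\tau_2}\,|T^{\sigma_1\sigma_2,\tau_1\tau_2}|_{\sigma_3\tau_3}\cdots t_{\sigma_n\tau_n}.$$
   Context: Parameters: $u$, $p_{ij}$, $q_{ij}$ ($1\le i<j\le n$) are complex numbers with $p_{ij}q_{ij}=u^2$ for $i<j$, $u^2\neq-1$. $\mathrm{M}_{p,u}(n)$ is the unital associative $\mathbb C$-algebra generated by $t_{ij}$, $1\le i,j\le n$, with relations, for $i<j$, $k<l$ (first relation for all $i$, second for all $k$): $t_{ik}t_{il}=q_{kl}t_{il}t_{ik}$; $t_{ik}t_{jk}=p_{ij}t_{jk}t_{ik}$; $q_{kl}t_{il}t_{jk}=p_{ij}t_{jk}t_{il}$; $q_{kl}^{-1}t_{ik}t_{jl}-q_{ij}^{-1}t_{jl}t_{ik}=(1-u^{-2})t_{il}t_{jk}$. Put $T=(t_{ij})$. For $\sigma\in S_n$, $(-q)_\sigma=(-1)^{l(\sigma)}\prod_{i<j,\ \sigma_i>\sigma_j}q_{\sigma_j\sigma_i}$ with $l(\sigma)$ the number of inversions, and ${\det}_q(T)=\sum_{\sigma\in S_n}(-q)_\sigma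 t_{1,\sigma_1}\cdots t_{n,\sigma_n}$. Quasideterminants: for a square matrix $X=(x_{ij})_{i\in I,j\in J}$ over a ring, invertible with inverse $Y=X^{-1}=(y_{ji})$, the $(i,j)$-th quasideterminant is $|X|_{ij}=y_{ji}^{-1}$; for a $1\times1$ matrix $|X|_{ij}=x_{ij}$. $T^{i_1\cdots i_r,\,j_1\cdots j_r}$ denotes the submatrix of $T$ obtained by deleting rows $i_1,\dots,i_r$ and columns $j_1,\dots,j_r$ (for $r=1$ also written $T^{i_1j_1}$), and its rows and columns keep their original labels; thus $|T^{11}|_{22}$ is the quasideterminant of the matrix with first row and column deleted at the position of $t_{22}$, and $T^{12,12}$ deletes rows $1,2$ and columns $1,2$. *)

(* Defs.v *)
From HB Require Import structures.
From mathcomp Require Import all_boot all_order all_algebra perm.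
From mathcomp Require Import boolp classical_sets.
From mathcomp Require Import finmap monalg.

Set Implicit Arguments.
Unset Strict Implicit.
Unset Printing Implicit Defensive.

Import GRing.Theory.

Local Open Scope ring_scope.
Local Open Scope quotient_scope.

Inductive in_ideal (A : nzRingType) (S : A -> Prop) : A -> Prop :=
| ideal_gen r of S r : in_ideal S r
| ideal_0 : in_ideal S 0
| ideal_add x y of in_ideal S x & in_ideal S y : in_ideal S (x + y)
| ideal_mull a x of in_ideal S x : in_ideal S (a * x)
| ideal_mulr a x of in_ideal S x : in_ideal S (x * a).

Fact free_scalerAr (K : comNzRingType) (X : choiceType) (c : K)
    (x y : {malg K[{fmonom X}]}) :
  c *: (x * y) = x * (c *: y).
Proof.
apply/malgP => m; rewrite mcoeffZ (mcoeffMlw m (fsubset_refl _) (fsubset_refl _)).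
rewrite (mcoeffMlw m (fsubset_refl _) (msuppZ_le c y)) mulr_sumr.
apply: eq_bigr => k1 _; rewrite mulr_sumr; apply: eq_bigr => k2 _.
by rewrite mcoeffZ mulrCA mulrnAr.
Qed.

Section QuantumMatrices.
Variables (K : fieldType) (n : nat) (p q : 'I_n -> 'I_n -> K) (u : K).

Local Notation F := {malg K[{fmonom ('I_n * 'I_n)%type}]}.
Definition free_gen (i j : 'I_n) : F := << fmu (i, j) >>.
Local Notation "''t_' ( i , j )" := (free_gen i j) (format "''t_' ( i ,  j )").

Inductive mx_relator : F -> Prop :=
| relator_row (i k l : 'I_n) of (k < l)%N :
    mx_relator ('t_(i, k) * 't_(i, l) - q k l *: ('t_(i, l) * 't_(i, k)))
| relator_col (i j k : 'I_n) of (i < j)%N :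
    mx_relator ('t_(i, k) * 't_(j, k) - p i j *: ('t_(j, k) * 't_(i, k)))
| relator_antidiag (i j k l : 'I_n) of (i < j)%N & (k < l)%N :
    mx_relator (q k l *: ('t_(i, l) * 't_(j, k))
                - p i j *: ('t_(j, k) * 't_(i, l)))
| relator_diag (i j k l : 'I_n) of (i < j)%N & (k < l)%N :
    mx_relator ((q k l)^-1 *: ('t_(i, k) * 't_(j, l))
                - (q i j)^-1 *: ('t_(j, l) * 't_(i, k))
                - (1 - u ^- 2) *: ('t_(i, l) * 't_(j, k))).

Definition mx_ideal_pred : {pred F} := fun x => `[< in_ideal mx_relator x >].

Fact mx_ideal_zmod_closed : zmod_closed mx_ideal_pred.
Proof.
split=> [|x y /asboolP Ix /asboolP Iy]; apply/asboolP; first exact: ideal_0.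
by apply: ideal_add => //; rewrite -mulN1r; apply: ideal_mull.
Qed.

HB.instance Definition _ := GRing.isZmodClosed.Build F mx_ideal_pred mx_ideal_zmod_closed.

Local Notation eps := (mcoeff (mone : {fmonom ('I_n * 'I_n)%type})).

Fact mx_ideal_mcoeff1 (x : F) : in_ideal mx_relator x -> eps x = 0.
Proof.
have epsM (a b : F) : eps (a * b) = eps a * eps b := rmorphM eps a b.
have tt0 i j k l : eps ('t_(i, j) * 't_(k, l)) = 0.
  rewrite epsM /free_gen mcoeffU1; case: eqP => [/(congr1 (@fmonom_val _))|_].
    by rewrite fmuE fm1.
  by rewrite mul0r.
have epsB0 (a b : F) : eps a = 0 -> eps b = 0 -> eps (a - b) = 0.
  by move=> a0 b0; rewrite raddfB /= a0 b0 subrr.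
have epsZ0 (c : K) (a : F) : eps a = 0 -> eps (c *: a) = 0.
  by move=> a0; rewrite mcoeffZ a0 mulr0.
elim=> {x} [r [] *||x y _ x0 _ y0|a x _ x0|a x _ x0].
- exact: epsB0 (tt0 _ _ _ _) (epsZ0 _ _ (tt0 _ _ _ _)).
- exact: epsB0 (tt0 _ _ _ _) (epsZ0 _ _ (tt0 _ _ _ _)).
- exact: epsB0 (epsZ0 _ _ (tt0 _ _ _ _)) (epsZ0 _ _ (tt0 _ _ _ _)).
- exact: epsB0 (epsB0 _ _ (epsZ0 _ _ (tt0 _ _ _ _)) (epsZ0 _ _ (tt0 _ _ _ _)))
    (epsZ0 _ _ (tt0 _ _ _ _)).
- exact: mcoeff0.
- by rewrite mcoeffD x0 y0 addr0.
- by rewrite epsM x0 mulr0.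
- by rewrite epsM x0 mul0r.
Qed.

(* M_{p,u}(n) is the quotient of the free algebra by the two-sided ideal
   generated by the relators. *)
Definition qmx : Type := Quotient.quot mx_ideal_pred.

HB.instance Definition _ := GRing.Zmodule.on qmx.
HB.instance Definition _ := EqQuotient.on qmx.

Definition qmx_pi (x : F) : qmx := \pi_(Quotient.quot mx_ideal_pred) x.

Lemma qmx_piP x y : reflect (in_ideal mx_relator (x - y)) (qmx_pi x == qmx_pi y).
Proof. by rewrite /qmx_pi -Quotient.idealrBE; apply: asboolP. Qed.

Lemma qmx_pi_eq x y : in_ideal mx_relator (x - y) -> qmx_pi x = qmx_pi y.
Proof. by move=> /qmx_piP/eqP. Qed.

Lemma qmx_reprK x : qmx_pi (repr x) = x.
Proof. exact: reprK. Qed.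

Lemma qmx_repr_pi x : in_ideal mx_relator (repr (qmx_pi x) - x).
Proof. by apply/qmx_piP; rewrite qmx_reprK. Qed.

Lemma qmx_pi_is_zmod_morphism : zmod_morphism qmx_pi.
Proof. by move=> x y; rewrite /qmx_pi !piE. Qed.
HB.instance Definition _ := GRing.isZmodMorphism.Build F qmx qmx_pi qmx_pi_is_zmod_morphism.

Definition qmx_mul (x y : qmx) : qmx := qmx_pi (repr x * repr y).
Definition qmx_scale (c : K) (x : qmx) : qmx := qmx_pi (c *: repr x).

Lemma qmx_piM x y : qmx_pi (x * y) = qmx_mul (qmx_pi x) (qmx_pi y).
Proof.
apply/esym/qmx_pi_eq; set x' := repr _; set y' := repr _.
have -> : x' * y' - x * y = (x' - x) * y' + x * (y' - y).
  by rewrite mulrBl mulrBr addrA subrK.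
by apply: ideal_add; [apply: ideal_mulr|apply: ideal_mull]; apply: qmx_repr_pi.
Qed.

Lemma qmx_piZ c x : qmx_pi (c *: x) = qmx_scale c (qmx_pi x).
Proof.
apply/esym/qmx_pi_eq; rewrite -scalerBr -mul_malgC.
by apply: ideal_mull; apply: qmx_repr_pi.
Qed.

Fact qmx_mulA : associative qmx_mul.
Proof.
by move=> x y z; rewrite -(qmx_reprK x) -(qmx_reprK y) -(qmx_reprK z)
  -!qmx_piM mulrA.
Qed.
Fact qmx_mul1 : left_id (qmx_pi 1) qmx_mul.
Proof. by move=> x; rewrite -(qmx_reprK x) -qmx_piM mul1r. Qed.
Fact qmx_mulr1 : right_id (qmx_pi 1) qmx_mul.
Proof. by move=> x; rewrite -(qmx_reprK x) -qmx_piM mulr1. Qed.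
Fact qmx_mulDl : left_distributive qmx_mul +%R.
Proof.
by move=> x y z; rewrite -(qmx_reprK x) -(qmx_reprK y) -(qmx_reprK z)
  -!qmx_piM -!raddfD -!qmx_piM mulrDl.
Qed.
Fact qmx_mulDr : right_distributive qmx_mul +%R.
Proof.
by move=> x y z; rewrite -(qmx_reprK x) -(qmx_reprK y) -(qmx_reprK z)
  -!qmx_piM -!raddfD -!qmx_piM mulrDr.
Qed.
Fact qmx_1neq0 : qmx_pi 1 != 0.
Proof.
rewrite -(raddf0 qmx_pi); apply/qmx_piP => /mx_ideal_mcoeff1 /eqP.
by rewrite subr0 mcoeff1 eqxx oner_eq0.
Qed.

HB.instance Definition _ := GRing.Zmodule_isNzRing.Build qmx
  qmx_mulA qmx_mul1 qmx_mulr1 qmx_mulDl qmx_mulDr qmx_1neq0.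

Fact qmx_scaleA a b v : qmx_scale a (qmx_scale b v) = qmx_scale (a * b) v.
Proof. by rewrite -(qmx_reprK v) -!qmx_piZ scalerA. Qed.
Fact qmx_scale1 : left_id 1 qmx_scale.
Proof. by move=> v; rewrite -(qmx_reprK v) -!qmx_piZ scale1r. Qed.
Fact qmx_scaleDr : right_distributive qmx_scale +%R.
Proof.
by move=> a v w; rewrite -(qmx_reprK v) -(qmx_reprK w) -raddfD -!qmx_piZ
  scalerDr raddfD.
Qed.
Fact qmx_scaleDl v : {morph qmx_scale^~ v : a b / a + b}.
Proof. by move=> a b; rewrite -(qmx_reprK v) -!qmx_piZ scalerDl raddfD. Qed.

HB.instance Definition _ := GRing.Zmodule_isLmodule.Build K qmx
  qmx_scaleA qmx_scale1 qmx_scaleDr qmx_scaleDl.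

Fact qmx_scalerAl (c : K) (x y : qmx) : c *: (x * y) = (c *: x) * y.
Proof.
change (qmx_scale c (qmx_mul x y) = qmx_mul (qmx_scale c x) y).
rewrite -(qmx_reprK x) -(qmx_reprK y).
move: (repr x : F) (repr y : F) => x' y'.
rewrite -(qmx_piM x' y') -(qmx_piZ c (x' * y')) -(qmx_piZ c x') -(qmx_piM (c *: x') y').
exact: (congr1 qmx_pi (scalerAl c x' y')).
Qed.
HB.instance Definition _ := GRing.Lmodule_isLalgebra.Build K qmx qmx_scalerAl.

Fact qmx_scalerAr (c : K) (x y : qmx) : c *: (x * y) = x * (c *: y).
Proof.
change (qmx_scale c (qmx_mul x y) = qmx_mul x (qmx_scale c y)).
rewrite -(qmx_reprK x) -(qmx_reprK y).
move: (repr x : F) (repr y : F) => x' y'.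
rewrite -(qmx_piM x' y') -(qmx_piZ c (x' * y')) -(qmx_piZ c y') -(qmx_piM x' (c *: y')).
exact: (congr1 qmx_pi (free_scalerAr c x' y')).
Qed.
HB.instance Definition _ := GRing.Lalgebra_isAlgebra.Build K qmx qmx_scalerAr.

Fact qmx_pi_monoid_morphism : monoid_morphism qmx_pi.
Proof. by split=> // x y; rewrite qmx_piM. Qed.
HB.instance Definition _ := GRing.isMonoidMorphism.Build F qmx qmx_pi
  qmx_pi_monoid_morphism.
Fact qmx_pi_scalable : scalable qmx_pi.
Proof. by move=> c x; rewrite qmx_piZ. Qed.
HB.instance Definition _ := GRing.isScalable.Build K F qmx *:%R qmx_pi
  qmx_pi_scalable.

Definition gen_mx : 'M[qmx]_n := \matrix_(i, j) qmx_pi (free_gen i j).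
End QuantumMatrices.

Section QuantumDeterminant.
Variables (K : fieldType) (n : nat) (q : 'I_n -> 'I_n -> K).

Definition inversions (s : 'S_n) : {set 'I_n * 'I_n} :=
  [set ij : 'I_n * 'I_n | (ij.1 < ij.2)%N && (s ij.2 < s ij.1)%N].

Definition qsign (s : 'S_n) : K :=
  (-1) ^+ #|inversions s| * \prod_(ij in inversions s) q (s ij.2) (s ij.1).

Definition qdet (A : algType K) (X : 'M[A]_n) : A :=
  \sum_(s : 'S_n) qsign s *: \prod_(i < n) X i (s i).
End QuantumDeterminant.

(* The submatrix of X with rows I and columns J is handled through X itself, so
   that rows and columns keep their labels; its inverse is likewise stored in an
   n x n matrix, of which only the entries indexed by J x I are meaningful. *)
Section Quasideterminant.
Variables (D : unitRingType) (n : nat).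
Implicit Types (I J : {set 'I_n}) (X Y : 'M[D]_n).

Definition is_inverse_on I J X Y : Prop :=
  (forall i i', i \in I -> i' \in I ->
     \sum_(j in J) X i j * Y j i' = (i == i')%:R) /\
  (forall j j', j \in J -> j' \in J ->
     \sum_(i in I) Y j i * X i j' = (j == j')%:R).

Definition inverse_on I J X : 'M[D]_n :=
  xget 0 (is_inverse_on I J X : classical_sets.set 'M[D]_n).

Definition quasidet I J X (i j : 'I_n) : D :=
  if #|I| == 1%N then X i j else (inverse_on I J X j i)^-1.

Definition quasidet_defined I J X (i j : 'I_n) : Prop :=
  [/\ i \in I, j \in J, #|I| = #|J| &
      #|I| = 1%N \/
      (exists Y, is_inverse_on I J X Y) /\ inverse_on I J X j i \is a GRing.unit].

(* The indices s_k, s_(k+1), ... left after deleting the first k values of s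
   (k counted from 0). *)
Definition remaining (s : 'S_n) (k : 'I_n) : {set 'I_n} :=
  ~: [set s l | l : 'I_n & (l < k)%N].

Definition quasiminor X (s t : 'S_n) (k : 'I_n) : D :=
  quasidet (remaining s k) (remaining t k) X (s k) (t k).

Definition quasiminor_defined X (s t : 'S_n) (k : 'I_n) : Prop :=
  quasidet_defined (remaining s k) (remaining t k) X (s k) (t k).

Lemma is_inverse_on_uniq I J X Y Z : is_inverse_on I J X Y ->
  is_inverse_on I J X Z -> {in J & I, forall j i, Y j i = Z j i}.
Proof.
move=> [_ YX] [XZ _] j i jJ iI.
transitivity (\sum_(i' in I) \sum_(j' in J) Y j i' * X i' j' * Z j' i).
  under eq_bigr => i' i'I.
    under eq_bigr => j' _ do rewrite -mulrA.
    rewrite -mulr_sumr XZ //; over.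
  rewrite (bigD1 i) //= eqxx mulr1 big1 ?addr0 // => i' /andP[_ /negPf->].
  by rewrite mulr0.
rewrite exchange_big /=; under eq_bigr => j' j'J do rewrite -mulr_suml YX //.
rewrite (bigD1 j) //= eqxx mul1r big1 ?addr0 // => j' /andP[_ /negPf].
by rewrite eq_sym => ->; rewrite mul0r.
Qed.

Lemma inverse_onP I J X Y : is_inverse_on I J X Y ->
  {in J & I, forall j i, inverse_on I J X j i = Y j i}.
Proof.
move=> XY; have /= := xgetPex 0 (ex_intro (is_inverse_on I J X) Y XY).
by move=> /is_inverse_on_uniq; apply.
Qed.
End Quasideterminant.

(* f embeds A in its classical ring of (right) fractions D: every nonzero
   element of A becomes invertible. For a two-sided Ore domain A such as
   M_{p,u}(n), this D is also the ring of left fractions. *)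
Definition ring_of_fractions (A : nzRingType) (D : unitRingType) (f : A -> D) :
    Prop :=
  [/\ injective f,
      forall a, a != 0 -> f a \is a GRing.unit &
      forall d, exists a b, b != 0 /\ d = f a * (f b)^-1].

(* Main.v *)
(** Let the e_j generate the exterior algebra with e_k e_j = - q_jk e_j e_k for
    j < k and e_j^2 = 0.  The relations of M_{p,u}(n) say that the rows
    w_i = \sum_j t_ij e_j satisfy the same relations as the e_i, so that a
    product of rows has the row minors as its coefficients, and multiplying by
    one more row on the left is a Laplace expansion: it exhibits a right inverse
    of every square submatrix, with entries (minor) * (minor)^-1.  The columns,
    multiplied on the right, satisfy the relations of the exterior algebra for
    p, which gives Laplace expansions of column minors.  Evaluating
    X * adj * X in two ways relates the row and the column minor, and comparing
    at the corner entry, which q-commutes with all the entries, shows that they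
    are equal.  Hence X_ij q-commutes with the minor, the right inverse is a
    two-sided inverse, the quasideterminants are quotients of minors, and the
    product telescopes.  Principal minors commute because the commutation
    factors of X_ij with a minor are of the form g_i / g_j.  The minors do not
    vanish because sending t_(i, s i) to q-commuting creation operators, for an
    increasing bijection s, and the other t_ij to 0 is a representation. *)
Require Import Defs.
From HB Require Import structures.
From mathcomp Require Import finmap monalg.
From mathcomp Require Import all_boot all_order all_algebra perm.
From mathcomp Require Import complex reals.
From mathcomp Require Import ring.

Set Implicit Arguments.
Unset Strict Implicit.
Unset Printing Implicit Defensive.

Import GRing.Theory.
Local Open Scope ring_scope.

(** * Wedge products of rows *)

(** Every pair of indices is met twice, once in each order; adding the two visits is what makes the
    brackets appear in [wedge_wedge]. *)
Lemma sum_offdiag (V : nmodType) (n : nat) (S : {set 'I_n}) (G : 'I_n -> 'I_n -> V) :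
  \sum_(l in S) \sum_(k in S :\ l) G l k =
  \sum_(l in S) \sum_(k in S | (k < l)%N) (G l k + G k l).
Proof.
have -> : \sum_(l in S) \sum_(k in S :\ l) G l k =
    \sum_(l in S) (\sum_(k in S | (k < l)%N) G l k
                   + \sum_(k in S | (l < k)%N) G l k).
  apply: eq_bigr => l lS; rewrite (bigID (fun k : 'I_n => (k < l)%N)) /=.
  congr (_ + _); apply: eq_bigl => k; rewrite !inE -(inj_eq val_inj) /=;
  by case: ltngtP; rewrite ?andbT ?andbF.
rewrite big_split /= [X in _ + X](exchange_big_dep (fun k => k \in S)) /=; last first.
  by move=> l k _ /andP[].
rewrite -big_split /=; apply: eq_bigr => l lS; rewrite big_split /=.
by congr (_ + _); apply: eq_bigl => k; rewrite lS.
Qed.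

Lemma big_uniq_all (R : Type) (idx : R) (op : Monoid.com_law idx) (T : finType)
    (s : seq T) (P : pred T) (F : T -> R) : uniq s -> (forall i, i \in s) ->
  \big[op/idx]_(i <- s | P i) F i = \big[op/idx]_(i | P i) F i.
Proof.
move=> us sT; apply: perm_big; apply: uniq_perm => //; first exact: index_enum_uniq.
by move=> i; rewrite sT mem_index_enum.
Qed.

Section Wedge.
Variables (K : fieldType) (n : nat) (A : algType K) (kap : 'I_n -> 'I_n -> K).
Implicit Types (I J S : {set 'I_n}) (x y : 'I_n -> A).
Implicit Types (v : {ffun {set 'I_n} -> A}).

(* [kap] encodes the relations [kap l k *: (e_l * e_k) = kap k l *: (e_k * e_l)];
   [wsign j S] is the factor in [e_j * e_S = wsign j S *: e_(j |: S)], and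
   [wedge x] is left multiplication by [\sum_j x_j e_j], a vector being the
   function of its coefficients on the [e_S]. *)
Definition wsign (j : 'I_n) S : K := \prod_(l in S) kap l j.

Definition wedge x v : {ffun {set 'I_n} -> A} :=
  [ffun S : {set 'I_n} => \sum_(j in S) wsign j (S :\ j) *: (x j * v (S :\ j))].

Lemma wsignD1 k j S : k \in S -> wsign j S = kap k j * wsign j (S :\ k).
Proof. by move=> kS; rewrite /wsign (big_setD1 k). Qed.

Lemma wedgeZ x c v : wedge x (c *: v) = c *: wedge x v.
Proof.
apply/ffunP => S; rewrite !ffunE scaler_sumr; apply: eq_bigr => j _.
by rewrite ffunE -scalerAr !scalerA mulrC.
Qed.

Lemma wedge0 x : wedge x 0 = 0.
Proof.
apply/ffunP => S; rewrite !ffunE big1 // => j _.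
by rewrite ffunE mulr0 scaler0.
Qed.

(** For [k != l] this is the coefficient on $e_{\{k,l\}}$ of the product of [\sum_j y_j e_j] by
    [\sum_j x_j e_j]. Identities between products of two rows thereby reduce to identities between
    brackets. *)
Definition wbracket x y (k l : 'I_n) : A :=
  kap k l *: (y l * x k) + kap l k *: (y k * x l).

Lemma wedge_wedge x y v S : wedge y (wedge x v) S =
  \sum_(l in S) \sum_(k in S | (k < l)%N)
     (wsign l (S :\ l :\ k) * wsign k (S :\ l :\ k)) *:
        (wbracket x y k l * v (S :\ l :\ k)).
Proof.
rewrite ffunE; transitivity (\sum_(l in S) \sum_(k in S :\ l)
     (wsign l (S :\ l :\ k) * wsign k (S :\ l :\ k)) *:
        (kap k l *: (y l * x k) * v (S :\ l :\ k))).
  apply: eq_bigr => l lS; rewrite ffunE mulr_sumr scaler_sumr.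
  apply: eq_bigr => k kS; rewrite (wsignD1 l kS) -scalerAr scalerA -!scalerAl.
  by rewrite scalerA mulrA; congr (_ *: _); ring.
rewrite sum_offdiag; apply: eq_bigr => l lS; apply: eq_bigr => k /andP[kS _].
have -> : S :\ k :\ l = S :\ l :\ k by rewrite !setDDl setUC.
by rewrite [wsign k _ * _]mulrC -scalerDr -mulrDl.
Qed.

Section Rows.
Variable X : 'I_n -> 'I_n -> A.
Hypothesis X_self : forall i k l : 'I_n, (k < l)%N -> wbracket (X i) (X i) k l = 0.
Hypothesis X_swap : forall i j k l : 'I_n, (i < j)%N -> (k < l)%N ->
  kap i j *: wbracket (X j) (X i) k l = kap j i *: wbracket (X i) (X j) k l.

Lemma wedge_self i v : wedge (X i) (wedge (X i) v) = 0.
Proof.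
apply/ffunP => S; rewrite wedge_wedge ffunE big1 // => l _.
by rewrite big1 // => k /andP[_ kl]; rewrite X_self // mul0r scaler0.
Qed.

Lemma wedge_swap i j v : i != j ->
  kap i j *: wedge (X i) (wedge (X j) v) = kap j i *: wedge (X j) (wedge (X i) v).
Proof.
wlog ij : i j / (i < j)%N => [H ij|_].
  have [/H-> //|ji|/val_inj/eqP/negPn] := ltngtP i j; last by rewrite ij.
  by rewrite (H j i) // eq_sym.
apply/ffunP => S; rewrite ffunE [RHS]ffunE !wedge_wedge !scaler_sumr.
apply: eq_bigr => l _; rewrite !scaler_sumr; apply: eq_bigr => k /andP[_ kl].
rewrite !scalerA ![kap _ _ * _]mulrC -!scalerA; congr (_ *: _).
by rewrite !scalerAl X_swap.
Qed.

Definition wvac : {ffun {set 'I_n} -> A} :=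
  [ffun S : {set 'I_n} => (S == set0)%:R].

Definition wprod (s : seq 'I_n) := foldr (fun i => wedge (X i)) wvac s.

(** Row [i] travels to the right, to its place in [s]. Passing an earlier row [l] costs [kap l i],
    because [kap i l = 1]; meeting itself gives 0. Later rows have [kap l i = 1], so the product may
    run over all of [I]. *)
Lemma wedge_wprod (s : seq 'I_n) I i :
    pairwise (fun a b => kap b a == 1) s -> uniq s -> i \in s ->
  wedge (X i) (wprod (filter (mem I) s)) =
  if i \in I then 0
  else (\prod_(l <- s | l \in I) kap l i) *: wprod (filter (mem (i |: I)) s).
Proof.
elim: s => //= a s IHs /andP[/allP a_s s_s] /andP[as_ us].
rewrite inE big_cons in_setU1 => /predU1P[eia|i_s].
  rewrite -{a}eia in a_s as_ *; rewrite eqxx /=; case: ifP => iI /=.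
    by rewrite wedge_self.
  rewrite big_seq_cond big1 ?scale1r => [|l /andP[/a_s/eqP->] //].
  congr (wedge _ (wprod _)); apply: eq_in_filter => l ls /=.
  by rewrite in_setU1; case: eqP as_ => // <-; rewrite ls.
have ia : i != a by apply: contraNneq as_ => <-.
have kia : kap i a = 1 by apply/eqP/a_s.
rewrite eq_sym (negPf ia) /=; case: ifP => aI /=; last exact: IHs.
have := wedge_swap (wprod [seq x <- s | x \in I]) ia.
rewrite kia scale1r => ->; rewrite IHs //.
by case: ifP => _; rewrite ?wedge0 ?scaler0 // wedgeZ scalerA.
Qed.

Section Minors.
Variable s : seq 'I_n.
Hypotheses (s_ord : pairwise (fun a b => kap b a == 1) s) (s_uniq : uniq s).
Hypothesis s_all : forall i, i \in s.

Definition wminor I J : A := wprod (filter (mem I) s) J.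

(** Coefficient on [J] of row [i] times the product of the rows in [I :\ i']. For [i != i'] the row
    [i] occurs twice. *)
Lemma wminor_row_expansion I J i i' : i \in I -> i' \in I ->
  \sum_(j in J) wsign j (J :\ j) *: (X i j * wminor (I :\ i') (J :\ j)) =
  if i == i' then wsign i (I :\ i) *: wminor I J else 0.
Proof.
move=> iI i'I.
have := wedge_wprod (I :\ i') s_ord s_uniq (s_all i) => /ffunP/(_ J).
rewrite ffunE => ->; rewrite !inE iI andbT.
case: eqP => [<-|_] /=; last by rewrite ffunE.
by rewrite setD1K // ffunE big_uniq_all.
Qed.

Lemma wminor0 : wminor set0 set0 = 1.
Proof.
rewrite /wminor (@eq_filter _ _ pred0) => [|i]; last by rewrite !inE.
by rewrite filter_pred0 ffunE eqxx.
Qed.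

Lemma wminor1 i j : wminor [set i] [set j] = X i j.
Proof.
have := @wminor_row_expansion [set i] [set j] i i (set11 i) (set11 i).
rewrite big_set1 !setDv wminor0 /wsign !big_set0 !scale1r mulr1.
by rewrite eqxx.
Qed.

(** Each term of the minor uses every row of [I] and every column of [J] exactly once, so all terms
    pick up the same factor. *)
Lemma wminor_comm I J (y : A) (P Q : 'I_n -> K) :
    {in I & J, forall i j, y * X i j = (P i * Q j) *: (X i j * y)} ->
  y * wminor I J =
  (\prod_(i in I) P i * \prod_(j in J) Q j) *: (wminor I J * y).
Proof.
move=> yX; rewrite /wminor.
have -> : \prod_(i in I) P i = \prod_(i <- filter (mem I) s) P i.
  by rewrite big_filter (big_uniq_all _ _ _ s_uniq).
have : {subset filter (mem I) s <= I} by move=> i; rewrite mem_filter => /andP[].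
elim: (filter (mem I) s) J yX => [|i l IHl] J yX lI /=.
  rewrite ffunE big_nil mul1r; case: eqP => [->|_].
    by rewrite big_set0 scale1r mulr1 mul1r.
  by rewrite mulr0 mul0r scaler0.
rewrite ffunE mulr_sumr mulr_suml scaler_sumr; apply: eq_bigr => j jJ.
rewrite -scalerAr mulrA yX //; last by apply: lI; rewrite mem_head.
rewrite -!scalerAl -!mulrA (IHl (J :\ j)); first last.
- by move=> a al; apply: lI; rewrite inE al orbT.
- by move=> a b aI; rewrite inE => /andP[_ /yX->].
rewrite -scalerAr !scalerA big_cons [in RHS](big_setD1 j) //=; congr (_ *: _); ring.
Qed.

End Minors.
End Rows.
End Wedge.

(** * The quantum determinant as a product of rows *)

(** The value 1 for [k <= l] makes increasing products of the $e_j$ free of factors; the other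
    values are the factors of [qsign]. *)
Definition row_kap (K : fieldType) (n : nat) (q : 'I_n -> 'I_n -> K) (l k : 'I_n) : K :=
  if (l < k)%N then - q l k else 1.

Lemma row_kap_ord (K : fieldType) (n : nat) (q : 'I_n -> 'I_n -> K) :
  pairwise (fun a b : 'I_n => row_kap q b a == 1) (enum 'I_n).
Proof.
have : pairwise ltn (map val (enum 'I_n)).
  by rewrite val_enum_ord -sorted_pairwise ?iota_ltn_sorted //; exact: ltn_trans.
rewrite pairwise_map; apply: sub_pairwise => a b /= ab.
by rewrite /row_kap ltnNge ltnW.
Qed.

(** Inversions are grouped by their left position [a]: moving $e_{s(a)}$ into place among the
    $e_{s(b)}$ with $b > a$ costs one factor per inversion. *)
Lemma qsignE (K : fieldType) (n : nat) (q : 'I_n -> 'I_n -> K) (s : 'S_n) :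
  qsign q s =
  \prod_a wsign (row_kap q) (s a) (s @: [set b : 'I_n | (a < b)%N]).
Proof.
rewrite /qsign -prodrN /=; transitivity (\prod_(a : 'I_n) \prod_(b : 'I_n |
    (a < b)%N && (s b < s a)%N) - q (s b) (s a)).
  by rewrite pair_big_dep /=; apply: eq_bigl => -[a b]; rewrite inE.
apply: eq_bigr => a _; rewrite /wsign big_imset /=; last by move=> ? ? _ _ /perm_inj.
rewrite -big_mkcondr /=; apply: eq_bigl => b.
by rewrite inE.
Qed.

Section QdetMinor.
Variables (K : fieldType) (n : nat) (A : algType K) (kap : 'I_n -> 'I_n -> K).
Variable X : 'I_n -> 'I_n -> A.

(** The reference permutation [s0] freezes the values outside [l], so that a partial product of rows
    is a sum over full permutations. The induction peels off the first row [i] and sorts the sum by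
    the value [s i]. *)
Lemma perm_sum_wprod (l : seq 'I_n) (s0 : 'S_n) :
    pairwise (fun a b : 'I_n => (a < b)%N) l ->
  \sum_(s : 'S_n | [forall i, (i \notin l) ==> (s i == s0 i)])
     (\prod_(a <- l) wsign kap (s a) (s @: [set b in l | (a < b)%N])) *:
     \prod_(i <- l) X i (s i)
  = wprod kap X l (s0 @: [set i in l]).
Proof.
elim: l s0 => [|i l IHl] s0 /=.
  move=> _; rewrite ffunE (big_pred1 s0) => [|s].
    rewrite !big_nil scale1r; case: eqP => // /eqP/set0Pn[j].
    by case/imsetP=> k; rewrite inE.
  rewrite [RHS]eq_sym; apply/forallP/eqP => [ss|<- //].
  by apply/permP => k; rewrite (eqP (ss k)).
case/andP=> /allP il l_ord; rewrite ffunE.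
have iNl : i \notin l by apply/negP => /il; rewrite ltnn.
set S := s0 @: _.
have agree_img (s : 'S_n) :
    [forall j, (j \notin i :: l) ==> (s j == s0 j)] -> s @: [set j in i :: l] = S.
  move=> /forallP ss; rewrite /S.
  (* Agreement with [s0] is known only off the list, hence the passage to complements. *)
  have img_setC (t : 'S_n) (L : {set 'I_n}) : t @: L = ~: (t @: ~: L).
    apply/setP => y; rewrite -(permKV t y) !inE !(mem_imset _ _ (@perm_inj _ t)).
    by rewrite inE negbK.
  rewrite [LHS]img_setC [RHS]img_setC; congr (~: _); apply: eq_in_imset => k.
  by rewrite 2!inE => kl; apply/eqP/(implyP (ss k)).
rewrite (partition_big (fun s : 'S_n => s i) (fun j => j \in S)) /=; last first.
  by move=> s /agree_img <-; rewrite mem_imset ?inE ?eqxx //; exact: perm_inj.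
(* The transposition imposes the value [j] at [i]; it changes nothing off [i :: l], where neither
   [s0 i] nor [j] is taken. *)
apply: eq_bigr => j jS; pose sj := (s0 * tperm (s0 i) j)%g.
have agreeE (s : 'S_n) : [forall k, (k \notin i :: l) ==> (s k == s0 k)] && (s i == j)
    = [forall k, (k \notin l) ==> (s k == sj k)].
  have sjE k : k \notin i :: l -> sj k = s0 k.
    rewrite inE negb_or => /andP[ki kl]; rewrite permM tpermD //.
      by rewrite (inj_eq perm_inj) eq_sym.
    apply: contraTneq jS => ->; rewrite mem_imset; last exact: perm_inj.
    by rewrite !inE negb_or ki.
  have sji : sj i = j by rewrite permM tpermL.
  apply/andP/forallP => [[/forallP ss /eqP si] k|ss].
    apply/implyP => kl; have [->|ki] := eqVneq k i; first by rewrite si sji.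
    have kil : k \notin i :: l by rewrite inE negb_or ki.
    by rewrite (eqP (implyP (ss k) kil)) sjE.
  split; last by have /implyP/(_ iNl) := ss i; rewrite sji.
  apply/forallP => k; apply/implyP => kil; rewrite -sjE //.
  by apply: (implyP (ss k)); apply: contra kil; rewrite inE orbC => ->.
have img_l (s : 'S_n) : [forall k, (k \notin i :: l) ==> (s k == s0 k)] && (s i == j) ->
    s @: [set k in l] = S :\ j.
  case/andP=> /agree_img <- /eqP <-; apply/setP => y; rewrite -(permKV s y) in_setD1.
  rewrite !(mem_imset _ _ (@perm_inj _ s)) (inj_eq perm_inj) !inE.
  by case: eqP => //= ->; apply/negbTE.
have <- : sj @: [set k in l] = S :\ j.
  by apply: img_l; rewrite agreeE; apply/forallP => k; rewrite eqxx implybT.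
rewrite -IHl // mulr_sumr scaler_sumr (eq_bigl _ _ agreeE).
apply: eq_bigr => s sP; rewrite !big_cons -scalerAr scalerA.
have /img_l sl := etrans (agreeE s) sP.
have /andP[_ /eqP si] := etrans (agreeE s) sP.
have sjl : sj @: [set k in l] = S :\ j.
  by apply: img_l; rewrite agreeE; apply/forallP => k; rewrite eqxx implybT.
have tail_i : [set b in i :: l | (i < b)%N] = [set b in l].
  apply/setP => k; rewrite !inE; case: eqP => [->|_] /=.
    by rewrite ltnn (negPf iNl).
  by case: (boolP (k \in l)) => // /il.
have tail_l a : a \in l -> [set b in i :: l | (a < b)%N] = [set b in l | (a < b)%N].
  move=> al; apply/setP => k; rewrite !inE; case: eqP => //= ->.
  by rewrite (negPf iNl) ltnNge ltnW // il.
rewrite sjl -sl si tail_i; congr (_ * _ *: _).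
by rewrite !big_seq; apply: eq_bigr => a /tail_l ->.
Qed.

End QdetMinor.

Lemma qdet_wminor (K : fieldType) (n : nat) (A : algType K) (q : 'I_n -> 'I_n -> K)
    (X : 'M[A]_n) :
  qdet q X = wminor (row_kap q) X (enum 'I_n) setT setT.
Proof.
rewrite /wminor (@eq_filter _ _ predT) => [|i]; last by rewrite /= inE.
rewrite filter_predT; have -> : [set: 'I_n] = (1%g : 'S_n) @: [set i in enum 'I_n].
  apply/setP => i; rewrite inE; apply/esym/imsetP; exists i; rewrite ?perm1 //.
  by rewrite inE mem_enum.
rewrite -perm_sum_wprod; last first.
  have : pairwise ltn (map val (enum 'I_n)).
    by rewrite val_enum_ord -sorted_pairwise ?iota_ltn_sorted //; exact: ltn_trans.
  by rewrite pairwise_map.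
apply: eq_big => [s|s _].
  by apply/esym/forallP => i; rewrite mem_enum.
rewrite qsignE; congr (_ *: _); last by rewrite enumT.
rewrite big_enum; apply: eq_big => // a _.
have -> // : [set b in enum 'I_n | (a < b)%N] = [set b : 'I_n | (a < b)%N].
by apply/setP => b; rewrite !inE mem_enum.
Qed.

Lemma wprod_map (K : fieldType) (n : nat) (A B : algType K) (f : {lrmorphism A -> B})
    (kap : 'I_n -> 'I_n -> K) (X : 'I_n -> 'I_n -> A) (l : seq 'I_n) S :
  f (wprod kap X l S) = wprod kap (fun i j => f (X i j)) l S.
Proof.
elim: l S => [|i l IHl] S /=; rewrite !ffunE; first by case: eqP; rewrite ?rmorph1 ?rmorph0.
rewrite raddf_sum; apply: eq_bigr => j _.
by rewrite -IHl -rmorphM; exact: linearZ.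
Qed.

Lemma eq_wprod (K : fieldType) (n : nat) (A : algType K)
    (kap : 'I_n -> 'I_n -> K) (X Y : 'I_n -> 'I_n -> A) (l : seq 'I_n) :
  X =2 Y -> wprod kap X l = wprod kap Y l.
Proof.
move=> XY; elim: l => //= i l ->; apply/ffunP => S; rewrite !ffunE.
by apply: eq_bigr => j _; rewrite XY.
Qed.

(** * Row and column minors *)

(** The converse ring keeps the scaling of [A] and is again an algebra, to which the theory of rows
    applies. *)
HB.instance Definition _ (K : pzRingType) (V : lmodType K) := GRing.Lmodule.on V^c.

Fact converse_scalerAl (K : comNzRingType) (A : algType K) (c : K) (x y : A^c) :
  c *: (x * y) = @GRing.mul A^c (c *: x) y.
Proof. exact: (scalerAr c (y : A) (x : A)). Qed.
HB.instance Definition _ (K : comNzRingType) (A : algType K) :=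
  GRing.Lmodule_isLalgebra.Build K A^c (@converse_scalerAl K A).

Fact converse_scalerAr (K : comNzRingType) (A : algType K) (c : K) (x y : A^c) :
  c *: (x * y) = @GRing.mul A^c x (c *: y).
Proof. exact: (scalerAl c (y : A) (x : A)). Qed.
HB.instance Definition _ (K : comNzRingType) (A : algType K) :=
  GRing.Lalgebra_isAlgebra.Build K A^c (@converse_scalerAr K A).

Definition col_kap (K : fieldType) (n : nat) (p : 'I_n -> 'I_n -> K) (l k : 'I_n) : K :=
  if (k < l)%N then - p k l else 1.

Lemma col_kap_ord (K : fieldType) (n : nat) (p : 'I_n -> 'I_n -> K) :
  pairwise (fun a b : 'I_n => col_kap p b a == 1) (rev (enum 'I_n)).
Proof.
have : pairwise gtn (rev (map val (enum 'I_n))).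
  rewrite val_enum_ord -sorted_pairwise ?rev_sorted ?iota_ltn_sorted //.
  by move=> b a c ab bc; apply: ltn_trans ab.
rewrite -map_rev pairwise_map; apply: sub_pairwise => a b /= ab.
by rewrite /col_kap ltnNge ltnW.
Qed.

(** Stated over any algebra, since it serves for the generators, for their images in the ring of
    fractions and for matrices of creation operators. *)
Record qmx_rel (K : fieldType) (n : nat) (p q : 'I_n -> 'I_n -> K) (u : K)
    (A : algType K) (X : 'I_n -> 'I_n -> A) : Prop := QmxRel {
  qmx_row : forall i k l : 'I_n, (k < l)%N ->
    X i k * X i l = q k l *: (X i l * X i k);
  qmx_col : forall i j k : 'I_n, (i < j)%N ->
    X i k * X j k = p i j *: (X j k * X i k);
  qmx_antidiag : forall i j k l : 'I_n, (i < j)%N -> (k < l)%N ->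
    q k l *: (X i l * X j k) = p i j *: (X j k * X i l);
  qmx_diag : forall i j k l : 'I_n, (i < j)%N -> (k < l)%N ->
    (q k l)^-1 *: (X i k * X j l) =
    (q i j)^-1 *: (X j l * X i k) + (1 - u ^- 2) *: (X i l * X j k) }.

Section Relations.
Variables (K : fieldType) (n : nat) (p q : 'I_n -> 'I_n -> K) (u : K).
Hypothesis u_neq0 : u != 0.
Hypothesis pq_u2 : forall i j : 'I_n, (i < j)%N -> p i j * q i j = u ^+ 2.

Lemma p_neq0 (i j : 'I_n) : (i < j)%N -> p i j != 0.
Proof.
by move/pq_u2; apply: contra_eq_neq => ->; rewrite mul0r eq_sym expf_neq0.
Qed.

Lemma q_neq0 (i j : 'I_n) : (i < j)%N -> q i j != 0.
Proof.
by move/pq_u2; apply: contra_eq_neq => ->; rewrite mulr0 eq_sym expf_neq0.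
Qed.

Lemma row_kap_neq0 (i j : 'I_n) : row_kap q i j != 0.
Proof. by rewrite /row_kap; case: ifP => [/q_neq0|]; rewrite ?oppr_eq0 ?oner_eq0. Qed.

Lemma col_kap_neq0 (i j : 'I_n) : col_kap p i j != 0.
Proof. by rewrite /col_kap; case: ifP => [/p_neq0|]; rewrite ?oppr_eq0 ?oner_eq0. Qed.

Lemma row_sign_neq0 (i : 'I_n) (I : {set 'I_n}) : wsign (row_kap q) i I != 0.
Proof. by apply/prodf_neq0 => l _; apply: row_kap_neq0. Qed.

Lemma col_sign_neq0 (i : 'I_n) (I : {set 'I_n}) : wsign (col_kap p) i I != 0.
Proof. by apply/prodf_neq0 => l _; apply: col_kap_neq0. Qed.

Section Algebra.
Variables (A : algType K) (X : 'I_n -> 'I_n -> A).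
Hypothesis X_rel : qmx_rel p q u X.

Lemma qmx_antidiagE (i j k l : 'I_n) : (i < j)%N -> (k < l)%N ->
  X j k * X i l = (q k l / p i j) *: (X i l * X j k).
Proof.
move=> ij kl; rewrite mulrC -scalerA (qmx_antidiag X_rel) // scalerA mulVf ?scale1r //.
exact: p_neq0.
Qed.

(** From $p_{ij} q_{ij} = u^2$ one gets $q_{ij}(1 - u^{-2}) = q_{ij} - p_{ij}^{-1}$. *)
Lemma qmx_diagE (i j k l : 'I_n) : (i < j)%N -> (k < l)%N ->
  X j l * X i k =
  (q i j / q k l) *: (X i k * X j l) - (q i j - (p i j)^-1) *: (X i l * X j k).
Proof.
move=> ij kl; have qij := q_neq0 ij; have pij := p_neq0 ij.
rewrite -scalerA (qmx_diag X_rel) // scalerDr !scalerA divff // scale1r.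
rewrite -(pq_u2 ij) mulrBr mulr1 invfM mulrCA divff // mulr1.
by rewrite addrK.
Qed.

Lemma row_bracket_self (i k l : 'I_n) : (k < l)%N ->
  wbracket (row_kap q) (X i) (X i) k l = 0.
Proof.
move=> kl; rewrite /wbracket /row_kap kl ltnNge ltnW //= scale1r scaleNr.
by rewrite (qmx_row X_rel i kl) addNr.
Qed.

(** Once the entries of row [i] stand on the left, both sides are combinations of [X i k * X j l]
    and [X i l * X j k] with equal coefficients. *)
Lemma row_bracket_swap (i j k l : 'I_n) : (i < j)%N -> (k < l)%N ->
  row_kap q i j *: wbracket (row_kap q) (X j) (X i) k l =
  row_kap q j i *: wbracket (row_kap q) (X i) (X j) k l.
Proof.
move=> ij kl; rewrite /wbracket /row_kap ij kl.
rewrite [(l < k)%N]ltnNge [(j < i)%N]ltnNge (ltnW kl) (ltnW ij) /=.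
rewrite !scale1r (qmx_antidiagE ij kl) (qmx_diagE ij kl).
have qij := q_neq0 ij; have pij := p_neq0 ij; have qkl := q_neq0 kl.
rewrite scalerDr scalerBr !scalerA.
rewrite [LHS]addrC -[RHS]addrA -scaleNr -scalerDl.
by congr (_ *: _ + _ *: _); field.
Qed.

Let Xc (j i : 'I_n) : A^c := X i j.

Lemma col_bracket_self (k i j : 'I_n) : (i < j)%N ->
  wbracket (col_kap p) (Xc k) (Xc k) i j = 0.
Proof.
move=> ij; rewrite /wbracket /col_kap ij ltnNge ltnW //= scale1r scaleNr.
by apply/eqP; rewrite subr_eq0; apply/eqP; exact: (qmx_col X_rel).
Qed.

Lemma col_bracket_swap (k l i j : 'I_n) : (k < l)%N -> (i < j)%N ->
  col_kap p k l *: wbracket (col_kap p) (Xc l) (Xc k) i j =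
  col_kap p l k *: wbracket (col_kap p) (Xc k) (Xc l) i j.
Proof.
move=> kl ij; rewrite /wbracket /col_kap ij kl.
rewrite [(l < k)%N]ltnNge [(j < i)%N]ltnNge (ltnW kl) (ltnW ij) /=.
have E (x y : A^c) : x * y = (y : A) * (x : A) by [].
rewrite !scale1r !E /Xc (qmx_antidiagE ij kl) (qmx_diagE ij kl).
have qij := q_neq0 ij; have pij := p_neq0 ij; have qkl := q_neq0 kl.
(* The row pair and the column pair are linked by the common value $u^2$ of the products $p q$. *)
have pkl : p k l = p i j * q i j / q k l.
  by rewrite (pq_u2 ij) -(pq_u2 kl) mulfK.
rewrite !(scalerBr, scalerDr) !scalerA addrCA -scaleNr.
rewrite -[X in _ + (X + _)]scale1r -scalerDl pkl.
by congr (_ *: _ + _ *: _); field; rewrite ?pij ?qij ?qkl.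
Qed.

Local Notation lm := (wminor (row_kap q) X (enum 'I_n)).

(* Right multiplication by a column becomes left multiplication in the converse
   algebra; the columns are then taken in decreasing order. *)
Definition col_minor (I J : {set 'I_n}) : A :=
  wminor (A := A^c) (col_kap p) (fun j i => X i j) (rev (enum 'I_n)) J I.

Lemma row_minor_expansion (I J : {set 'I_n}) (i i' : 'I_n) : i \in I -> i' \in I ->
  \sum_(j in J) wsign (row_kap q) j (J :\ j) *: (X i j * lm (I :\ i') (J :\ j)) =
  if i == i' then wsign (row_kap q) i (I :\ i) *: lm I J else 0.
Proof.
apply: wminor_row_expansion; [exact: row_bracket_self|exact: row_bracket_swap|..].
- exact: row_kap_ord.
- exact: enum_uniq.
- exact: mem_enum.
Qed.

Lemma col_minor_expansion (I J : {set 'I_n}) (j j' : 'I_n) : j \in J -> j' \in J ->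
  \sum_(i in I) wsign (col_kap p) i (I :\ i) *: (col_minor (I :\ i) (J :\ j) * X i j') =
  if j' == j then wsign (col_kap p) j' (J :\ j') *: col_minor I J else 0.
Proof.
move=> jJ j'J.
apply: (wminor_row_expansion (A := A^c) col_bracket_self col_bracket_swap) => //.
- exact: col_kap_ord.
- by rewrite rev_uniq enum_uniq.
- by move=> i; rewrite mem_rev mem_enum.
Qed.

Lemma row_minor0 : lm set0 set0 = 1.
Proof. exact: wminor0. Qed.

Lemma col_minor0 : col_minor set0 set0 = 1.
Proof. exact: (wminor0 (A := A^c)). Qed.

Lemma row_minor1 (i j : 'I_n) : lm [set i] [set j] = X i j.
Proof.
apply: wminor1; [exact: row_bracket_self|exact: row_bracket_swap|..].
- exact: row_kap_ord.
- exact: enum_uniq.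
- exact: mem_enum.
Qed.

(* Both sides are the sum of the [a_j' a'_i' X_ij' M_j'i' X_i'j], associated in
   the two ways, where [M] is the common matrix of complementary minors. *)
Lemma minor_intertwine (I J : {set 'I_n}) (i j : 'I_n) : i \in I -> j \in J ->
    {in I & J, forall i' j', col_minor (I :\ i') (J :\ j') = lm (I :\ i') (J :\ j')} ->
  (wsign (col_kap p) i (I :\ i) * wsign (row_kap q) i (I :\ i)) *: (lm I J * X i j) =
  (wsign (col_kap p) j (J :\ j) * wsign (row_kap q) j (J :\ j)) *: (X i j * col_minor I J).
Proof.
move=> iI jJ rl.
transitivity (\sum_(i' in I) \sum_(j' in J)
   (wsign (row_kap q) j' (J :\ j') * wsign (col_kap p) i' (I :\ i')) *:
   (X i j' * lm (I :\ i') (J :\ j') * X i' j)).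
  transitivity (\sum_(i' in I) wsign (col_kap p) i' (I :\ i') *:
      ((if i == i' then wsign (row_kap q) i (I :\ i) *: lm I J else 0) * X i' j)).
    rewrite (bigD1 i) //= eqxx -scalerAl scalerA big1 ?addr0 // => i' /andP[_].
    by rewrite eq_sym => /negPf->; rewrite mul0r scaler0.
  apply: eq_bigr => i' i'I; rewrite -row_minor_expansion // mulr_suml scaler_sumr.
  by apply: eq_bigr => j' _; rewrite -scalerAl scalerA mulrC.
rewrite exchange_big /=.
transitivity (\sum_(j' in J) wsign (row_kap q) j' (J :\ j') *:
    (X i j' * (if j == j' then wsign (col_kap p) j (J :\ j) *: col_minor I J else 0))).
  apply: eq_bigr => j' j'J; rewrite -col_minor_expansion // mulr_sumr scaler_sumr.
  by apply: eq_bigr => i' i'I; rewrite -scalerAr scalerA mulrA rl.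
rewrite (bigD1 j) //= eqxx -scalerAr scalerA mulrC big1 ?addr0 // => j' /andP[_].
by rewrite eq_sym => /negPf->; rewrite mulr0 scaler0.
Qed.

End Algebra.
End Relations.

(** * Quasideterminants as quotients of minors *)

Lemma eq_card_setD1 (T : finType) (I J : {set T}) (i j : T) :
  #|I| = #|J| -> i \in I -> j \in J -> #|I :\ i| = #|J :\ j|.
Proof. by move=> IJ iI jJ; move: IJ; rewrite (cardsD1 i I) (cardsD1 j J) iI jJ => -[]. Qed.

Section Quasiminors.
Variables (K : fieldType) (n : nat) (p q : 'I_n -> 'I_n -> K) (u : K).
Hypothesis u_neq0 : u != 0.
Hypothesis pq_u2 : forall i j : 'I_n, (i < j)%N -> p i j * q i j = u ^+ 2.
Variables (D : unitAlgType K) (X : 'M[D]_n).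
Hypothesis X_rel : qmx_rel p q u X.

Local Notation lm := (wminor (row_kap q) X (enum 'I_n)).
Local Notation wl := (wsign (row_kap q)).
Local Notation wr := (wsign (col_kap p)).
Implicit Types (I J L : {set 'I_n}).

Hypothesis lm_unit : forall I J, #|I| = #|J| -> lm I J \is a GRing.unit.

Let lq_neq0 := q_neq0 u_neq0 pq_u2.
Let wl_neq0 := row_sign_neq0 u_neq0 pq_u2.
Let wr_neq0 := col_sign_neq0 u_neq0 pq_u2.

(* The corner entry [x] in the first row and last column q-commutes with every
   entry, hence with the minor; comparing with [minor_intertwine] and cancelling
   [x] identifies the row and the column minors. *)
Lemma col_minor_row_minor I J : #|I| = #|J| -> col_minor p X I J = lm I J.
Proof.
elim: #|I| {-2}I (erefl #|I|) J => [|m IHm] {}I Im J Jm.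
  have /eqP I0 : I == set0 by rewrite -cards_eq0 Im.
  have /eqP J0 : J == set0 by rewrite -cards_eq0 -Jm Im.
  by rewrite I0 J0 col_minor0 row_minor0.
have [i0 i0I] : exists i, i \in I by apply/card_gt0P; rewrite Im.
have [j0 j0J] : exists j, j \in J by apply/card_gt0P; rewrite -Jm Im.
have [i iI imin] := arg_minnP (fun a : 'I_n => val a) i0I.
have [j jJ jmax] := arg_maxnP (fun a : 'I_n => val a) j0J.
have {}iI : i \in I := iI; have {}jJ : j \in J := jJ.
have {}imin a : a \in I -> a != i -> (i < a)%N.
  by move=> aI; rewrite ltn_neqAle (inj_eq val_inj) eq_sym => ->; apply: imin.
have {}jmax b : b \in J -> b != j -> (b < j)%N.
  by move=> bJ; rewrite ltn_neqAle (inj_eq val_inj) => ->; apply: jmax.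
have Ii : #|I :\ i| = m by move: Im; rewrite (cardsD1 i) iI => -[].
have Jj : #|J :\ j| = m by move: Jm; rewrite Im (cardsD1 j) jJ => -[].
have X_unit : X i j \is a GRing.unit.
  by rewrite -(row_minor1 u_neq0 pq_u2 X_rel) lm_unit ?cards1.
have := minor_intertwine u_neq0 pq_u2 X_rel iI jJ.
(* As [i] is minimal and [j] maximal, two of the four factors in [minor_intertwine] are 1. *)
have -> : wl i (I :\ i) = 1.
  rewrite /wsign big1 // => a; rewrite !inE => /andP[ai aI].
  by rewrite /row_kap ltnNge ltnW ?imin.
have -> : wr j (J :\ j) = 1.
  rewrite /wsign big1 // => b; rewrite !inE => /andP[bj bJ].
  by rewrite /col_kap ltnNge ltnW ?jmax.
rewrite mulr1 mul1r => inter.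
have {}inter : wr i (I :\ i) *: (lm I J * X i j) = wl j (J :\ j) *: (X i j * col_minor p X I J).
  apply: inter => i' j' i'I j'J; apply: IHm; last exact: eq_card_setD1.
  by move: Im; rewrite (cardsD1 i') i'I => -[].
(* The relations give [X i j * X a b] the factor $p_{ia} / q_{bj}$, where a part with [a = i] or
   [b = j] is read as 1. Written with [col_kap] and [row_kap], the products of these factors are
   [wr i (I :\ i)] and the inverse of [wl j (J :\ j)], up to signs that cancel. *)
pose P a := if a == i then 1 else - col_kap p a i.
pose Q b := if b == j then 1 else (- row_kap q b j)^-1.
have /wminor_comm : {in I & J, forall a b, X i j * X a b = (P a * Q b) *: (X a b * X i j)}.
  move=> a b aI bJ; rewrite /P /Q.
  have [->|ai] := eqVneq a i; have [->|bj] := eqVneq b j.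
  - by rewrite mulr1 scale1r.
  - rewrite mul1r /row_kap jmax // opprK (qmx_row X_rel i (jmax b bJ bj)) scalerA mulVf ?scale1r //.
    by apply: lq_neq0; apply: jmax.
  - by rewrite mulr1 /col_kap imin // opprK (qmx_col X_rel) ?imin.
  rewrite /row_kap /col_kap imin // jmax // !opprK mulrC -scalerA.
  rewrite -(qmx_antidiag X_rel) ?imin ?jmax // scalerA mulVf ?scale1r //.
  by apply: lq_neq0; apply: jmax.
move=> /(_ (row_kap q) (enum 'I_n) (enum_uniq _) (mem_enum _)).
have -> : \prod_(a in I) P a = (-1) ^+ m * wr i (I :\ i).
  rewrite (big_setD1 i) //= {1}/P eqxx mul1r -Ii -prodrN.
  by apply: eq_bigr => a; rewrite !inE => /andP[/negPf ai _]; rewrite /P ai.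
have -> : \prod_(b in J) Q b = ((-1) ^+ m * wl j (J :\ j))^-1.
  rewrite (big_setD1 j) //= {1}/Q eqxx mul1r -Jj -prodrN -prodfV.
  by apply: eq_bigr => b; rewrite !inE => /andP[/negPf bj _]; rewrite /Q bj.
move=> comm; apply: (mulrI X_unit); apply: (scalerI (wl_neq0 j (J :\ j))).
rewrite -inter comm scalerA; congr (_ *: _).
by field; rewrite wl_neq0 signr_eq0.
Qed.

(** With row and column minors identified, [minor_intertwine] becomes a q-commutation whose factor
    is a row weight over a column weight. *)
Lemma row_minor_intertwine I J i j : #|I| = #|J| -> i \in I -> j \in J ->
  (wr i (I :\ i) * wl i (I :\ i)) *: (lm I J * X i j) =
  (wr j (J :\ j) * wl j (J :\ j)) *: (X i j * lm I J).
Proof.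
move=> IJ iI jJ; rewrite -[in RHS]col_minor_row_minor //.
apply: (minor_intertwine u_neq0 pq_u2 X_rel) => // i' j' i'I j'J.
exact/col_minor_row_minor/eq_card_setD1.
Qed.

(** The entry in row [a] and column [b] commutes with the larger minor up to [w b / w a]; over rows
    and columns in the same set [L] these factors cancel. *)
Lemma row_minor_principal_comm I L : L \subset I ->
  lm I I * lm L L = lm L L * lm I I.
Proof.
move=> /subsetP LI; pose w a := wr a (I :\ a) * wl a (I :\ a).
have w_neq0 a : w a != 0 by rewrite mulf_neq0 ?wr_neq0 ?wl_neq0.
rewrite (@wminor_comm _ _ _ _ _ _ _ _ _ _ _ (fun a => (w a)^-1) w).
- rewrite -big_split big1 ?scale1r // => a _; exact: mulVf.
- exact: enum_uniq.
- exact: mem_enum.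
move=> a b aL bL /=; apply: (scalerI (w_neq0 a)).
by rewrite scalerA mulrA divff // mul1r row_minor_intertwine ?LI.
Qed.

(** The adjugate divided on the right by the minor; the quotient of the two [wl] plays the part of
    the cofactor sign. *)
Definition row_minor_inv I J : 'M[D]_n := \matrix_(j, i)
  ((wl j (J :\ j) / wl i (I :\ i)) *: (lm (I :\ i) (J :\ j) * (lm I J)^-1)).

(** The right inverse property is the row expansion. For the left one, the inverse minor is first
    moved past the entry by q-commutation, after which the column expansion applies. *)
Lemma row_minor_invP I J : #|I| = #|J| -> is_inverse_on I J X (row_minor_inv I J).
Proof.
move=> IJ; split=> [i i' iI i'I|j j' jJ j'J].
  transitivity ((wl i' (I :\ i'))^-1 *: (
      (if i == i' then wl i (I :\ i) *: lm I J else 0) * (lm I J)^-1)).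
    rewrite -(row_minor_expansion u_neq0 pq_u2 X_rel J iI i'I) mulr_suml scaler_sumr.
    apply: eq_bigr => j jJ; rewrite mxE mulrC -scalerA -scalerAr; congr (_ *: _).
    by rewrite -scalerAl -scalerAr mulrA.
  case: eqP => [->|_]; last by rewrite mul0r scaler0.
  by rewrite -scalerAl mulrV ?lm_unit // scalerA mulVf // scale1r.
transitivity ((wl j (J :\ j) / (wr j' (J :\ j') * wl j' (J :\ j'))) *: (
    (if j' == j then wr j' (J :\ j') *: col_minor p X I J else 0) * (lm I J)^-1)).
  rewrite -(col_minor_expansion u_neq0 pq_u2 X_rel I jJ j'J) mulr_suml scaler_sumr.
  apply: eq_bigr => i iI; rewrite mxE -!scalerAl scalerA -!mulrA.
  have -> : (lm I J)^-1 * X i j' =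
      ((wr i (I :\ i) * wl i (I :\ i)) / (wr j' (J :\ j') * wl j' (J :\ j'))) *:
      (X i j' * (lm I J)^-1).
    apply: (mulrI (lm_unit IJ)); apply: (mulIr (lm_unit IJ)).
    rewrite mulrA mulrV ?lm_unit // mul1r -scalerAr -scalerAl !mulrA.
    rewrite mulrVK ?lm_unit // mulrC -scalerA row_minor_intertwine //.
    by rewrite scalerA mulVf ?scale1r // mulf_neq0 ?wr_neq0 ?wl_neq0.
  rewrite -scalerAr scalerA col_minor_row_minor; last exact: eq_card_setD1.
  congr (_ *: _); field; rewrite !wl_neq0 !wr_neq0 //.
rewrite eq_sym; case: eqP => [->|_]; last by rewrite mul0r scaler0.
rewrite col_minor_row_minor // -scalerAl mulrV ?lm_unit // scalerA.
by rewrite [X in X *: _](_ : _ = 1) ?scale1r //; field; rewrite !wl_neq0 !wr_neq0.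
Qed.

Lemma quasidet_row_minor I J i j : #|I| = #|J| -> i \in I -> j \in J ->
  quasidet_defined I J X i j /\
  quasidet I J X i j =
    (wl i (I :\ i) / wl j (J :\ j)) *: (lm I J * (lm (I :\ i) (J :\ j))^-1).
Proof.
move=> IJ iI jJ; have invX := row_minor_invP IJ.
have IJ' : #|I :\ i| = #|J :\ j| by exact: eq_card_setD1.
have c_unit : wl j (J :\ j) / wl i (I :\ i) \is a GRing.unit.
  by rewrite unitfE mulf_neq0 ?invr_eq0.
have invE : inverse_on I J X j i = row_minor_inv I J j i by rewrite (inverse_onP invX).
split.
  split => //; right; split; first by exists (row_minor_inv I J).
  by rewrite invE mxE scaler_unit // unitrMr ?unitrV lm_unit.
(* In size 1 the quasideterminant is the entry by convention; the formula agrees because the empty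
   minor is 1. *)
rewrite /quasidet; case: eqP => [I1|_]; last first.
  rewrite invE mxE invrZ //; last by rewrite unitrMr ?unitrV lm_unit.
  by rewrite invf_div invrM ?unitrV ?lm_unit // invrK.
have /eqP -> : I == [set i] by rewrite eq_sym eqEcard sub1set iI I1 cards1.
have /eqP -> : J == [set j] by rewrite eq_sym eqEcard sub1set jJ -IJ I1 cards1.
rewrite !setDv (row_minor1 u_neq0 pq_u2 X_rel) row_minor0 /wsign !big_set0.
by rewrite !divr1 scale1r.
Qed.

(** Agrees with [remaining] for [k < n], but also allows [k = n], the empty set at which the
    telescoping ends. *)
Definition tail_image (s : 'S_n) (k : nat) : {set 'I_n} :=
  s @: [set l : 'I_n | (k <= l)%N].

Lemma tail_imageD1 s (k : 'I_n) : tail_image s k :\ s k = tail_image s k.+1.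
Proof.
apply/setP => y; rewrite -(permKV s y) in_setD1 !mem_imset; try exact: perm_inj.
by rewrite (inj_eq perm_inj) !inE ltn_neqAle eq_sym (inj_eq val_inj).
Qed.

Lemma remainingE s (k : 'I_n) : remaining s k = tail_image s k.
Proof.
apply/setP => y; rewrite -(permKV s y) inE !mem_imset; try exact: perm_inj.
by rewrite !inE -leqNgt.
Qed.

Lemma card_tail_image s t k : #|tail_image s k| = #|tail_image t k|.
Proof. by rewrite !card_imset //; exact: perm_inj. Qed.

Lemma quasiminor_row_minor s t (k : 'I_n) :
  quasiminor_defined X s t k /\
  quasiminor X s t k =
    (wl (s k) (tail_image s k.+1) / wl (t k) (tail_image t k.+1)) *:
    (lm (tail_image s k) (tail_image t k) *
     (lm (tail_image s k.+1) (tail_image t k.+1))^-1).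
Proof.
rewrite /quasiminor_defined /quasiminor !remainingE -!tail_imageD1.
apply: quasidet_row_minor; first exact: card_tail_image.
  by rewrite mem_imset ?inE //; exact: perm_inj.
by rewrite mem_imset ?inE //; exact: perm_inj.
Qed.

(** The scalars multiply to quantum signs by [qsignE], and the quotients of minors telescope from
    the full minor to the empty one. *)
Lemma prod_quasiminor s t :
  \prod_(k < n) quasiminor X s t k = (qsign q s / qsign q t) *: lm setT setT.
Proof.
have wlE (r : 'S_n) : \prod_(k < n) wl (r k) (tail_image r k.+1) = qsign q r.
  by rewrite qsignE.
pose m k := lm (tail_image s k) (tail_image t k).
have m_unit k : m k \is a GRing.unit by apply/lm_unit/card_tail_image.
rewrite (eq_bigr (fun k : 'I_n => (wl (s k) (tail_image s k.+1) /
   wl (t k) (tail_image t k.+1)) *: (m k * (m k.+1)^-1))); last first.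
  by move=> k _; rewrite (quasiminor_row_minor s t k).2.
rewrite scaler_prod prodf_div !wlE; congr (_ *: _).
have telescope N : \prod_(k < N) (m k * (m k.+1)^-1) = m 0%N * (m N)^-1.
  elim: N => [|N IHN]; first by rewrite big_ord0 mulrV.
  by rewrite big_ord_recr /= IHN mulrA mulrVK.
have tailT (r : 'S_n) : tail_image r 0 = setT.
  apply/setP => y; rewrite -(permKV r y) mem_imset ?inE //; exact: perm_inj.
have tail0 (r : 'S_n) : tail_image r n = set0.
  apply/setP => y; rewrite -(permKV r y) mem_imset ?inE; last exact: perm_inj.
  by rewrite leqNgt ltn_ord.
by rewrite telescope /m !tailT !tail0 row_minor0 invr1 mulr1.
Qed.

(** For the identity the tails are nested and the minors principal, so the minors commute, and with
    them their quotients. *)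
Lemma quasiminor1_comm (k l : 'I_n) :
  quasiminor X 1%g 1%g k * quasiminor X 1%g 1%g l =
  quasiminor X 1%g 1%g l * quasiminor X 1%g 1%g k.
Proof.
pose d a := lm (tail_image 1 a) (tail_image 1 a).
have d_unit a : d a \is a GRing.unit by apply/lm_unit.
have d_comm a b : GRing.comm (d a) (d b).
  wlog ab : a b / (a <= b)%N => [H|].
    by case: (leqP a b) => [/H//|/ltnW/H]; exact: commr_sym.
  apply/row_minor_principal_comm/imsetS/subsetP => c; rewrite !inE.
  exact: leq_trans.
have d_commV a b : GRing.comm (d a) (d b)^-1 by exact: commrV.
have dVV a b : GRing.comm (d a)^-1 (d b)^-1 by apply/commrV/commr_sym/commrV.
rewrite !(quasiminor_row_minor 1 1 _).2 !divff ?wl_neq0 // !scale1r.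
apply: commrM; apply: commr_sym; apply: commrM; first exact: d_comm.
- exact: d_commV.
- exact/commr_sym/d_commV.
exact: dVV.
Qed.

End Quasiminors.

(** * Minors do not vanish *)

Section FreeEval.
Variables (K : fieldType) (n : nat) (B : algType K) (X : 'I_n -> 'I_n -> B).
Local Notation F := {malg K[{fmonom ('I_n * 'I_n)%type}]}.

Definition monom_eval (m : {fmonom ('I_n * 'I_n)%type}) : B :=
  \prod_(x <- (m : seq _)) X x.1 x.2.

Fact monom_eval_mmorphism : mmorphism monom_eval.
Proof.
split=> [x y|]; first by rewrite /monom_eval fmM big_cat.
by rewrite /monom_eval fm1 big_nil.
Qed.
HB.instance Definition _ :=
  monalg.isMultiplicative.Build _ B monom_eval monom_eval_mmorphism.

Definition free_eval (x : F) : B := mmap (in_alg B) monom_eval x.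

Fact free_eval_zmod_morphism : zmod_morphism free_eval.
Proof. exact: mmapB. Qed.
HB.instance Definition _ :=
  GRing.isZmodMorphism.Build F B free_eval free_eval_zmod_morphism.

(** Although [B] may be noncommutative, it suffices that scalars are central in it. *)
Fact free_eval_monoid_morphism : monoid_morphism free_eval.
Proof.
have [] := @commr_mmap_is_multiplicative _ _ _ (in_alg B) monom_eval.
  by move=> g m m'; rewrite /GRing.comm mulr_algl mulr_algr.
by split.
Qed.
HB.instance Definition _ :=
  GRing.isMonoidMorphism.Build F B free_eval free_eval_monoid_morphism.

Fact free_eval_scalable : scalable free_eval.
Proof. by move=> c x; rewrite /free_eval mmapZ mulr_algl. Qed.
HB.instance Definition _ :=
  GRing.isScalable.Build K F B *:%R free_eval free_eval_scalable.

Lemma free_eval_gen (i j : 'I_n) : free_eval (free_gen K i j) = X i j.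
Proof.
rewrite /free_eval /free_gen mmapU /= scale1r mul1r /monom_eval fmU.
by rewrite big_seq1.
Qed.

Lemma free_eval_ideal (p q : 'I_n -> 'I_n -> K) (u : K) (x : F) :
  qmx_rel p q u X -> in_ideal (mx_relator p q u) x -> free_eval x = 0.
Proof.
move=> X_rel; have evM a b : free_eval (a * b) = free_eval a * free_eval b := rmorphM _ a b.
have evB a b : free_eval (a - b) = free_eval a - free_eval b := raddfB free_eval a b.
have evZ c a : free_eval (c *: a) = c *: free_eval a := free_eval_scalable c a.
have evXX i j k l : free_eval (free_gen K i j * free_gen K k l) = X i j * X k l.
  by rewrite evM; congr (_ * _); apply: free_eval_gen.
have evBE a b v w : free_eval a = v -> free_eval b = w -> free_eval (a - b) = v - w.
  by move=> <- <-.
have evZE c a w : free_eval a = w -> free_eval (c *: a) = c *: w by move=> <-.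
elim=> {x} [r [i k l kl|i j k ij|i j k l ij kl|i j k l ij kl]||y z _ y0 _ z0|a y _ y0|a y _ y0].
- apply: etrans (evBE _ _ _ _ (evXX _ _ _ _) (evZE _ _ _ (evXX _ _ _ _))) _.
  by apply/eqP; rewrite subr_eq0 (qmx_row X_rel i kl).
- apply: etrans (evBE _ _ _ _ (evXX _ _ _ _) (evZE _ _ _ (evXX _ _ _ _))) _.
  by apply/eqP; rewrite subr_eq0 (qmx_col X_rel k ij).
- apply: etrans (evBE _ _ _ _ (evZE _ _ _ (evXX _ _ _ _)) (evZE _ _ _ (evXX _ _ _ _))) _.
  by apply/eqP; rewrite subr_eq0 (qmx_antidiag X_rel ij kl).
- apply: etrans (evBE _ _ _ _ (evBE _ _ _ _ (evZE _ _ _ (evXX _ _ _ _))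
    (evZE _ _ _ (evXX _ _ _ _))) (evZE _ _ _ (evXX _ _ _ _))) _.
  by rewrite (qmx_diag X_rel ij kl) addrAC addrK subrr.
- exact: raddf0.
- by rewrite [LHS](raddfD free_eval) /= y0 z0 addr0.
- by rewrite evM y0 mulr0.
- by rewrite evM y0 mul0r.
Qed.

(** Universal property: evaluating a representative is well defined because the ideal evaluates to
    0. *)
Lemma qmx_lift (p q : 'I_n -> 'I_n -> K) (u : K) : qmx_rel p q u X ->
  exists f : {lrmorphism qmx p q u -> B}, forall i j, f (gen_mx p q u i j) = X i j.
Proof.
move=> X_rel; pose f (x : qmx p q u) := free_eval (repr x).
have f_pi x : f (qmx_pi p q u x) = free_eval x.
  apply/eqP; rewrite -subr_eq0 -(raddfB free_eval); apply/eqP.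
  exact: free_eval_ideal X_rel (qmx_repr_pi p q u x).
have fB : zmod_morphism f.
  move=> x y; rewrite -(qmx_reprK x) -(qmx_reprK y) -(raddfB (qmx_pi p q u)) !f_pi.
  exact: raddfB.
have fM : monoid_morphism f.
  split=> [|x y]; first by rewrite [LHS]f_pi; exact: rmorph1.
  rewrite -(qmx_reprK x) -(qmx_reprK y) -(rmorphM (qmx_pi p q u)) !f_pi.
  exact: rmorphM.
have fZ : scalable f.
  move=> c x; have <- : qmx_pi p q u (c *: repr x) = c *: x.
    by rewrite qmx_pi_scalable qmx_reprK.
  by rewrite f_pi; exact: free_eval_scalable.
pose fl : {lrmorphism qmx p q u -> B} := HB.pack f
  (GRing.isZmodMorphism.Build _ _ f fB) (GRing.isMonoidMorphism.Build _ _ f fM)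
  (GRing.isScalable.Build _ _ _ _ f fZ).
by exists fl => i j; rewrite mxE /= f_pi free_eval_gen.
Qed.
End FreeEval.

(** * Operators on a space with a finite basis *)

Section OperatorMatrix.
Variables (K : fieldType) (T : finType) (t0 : T).
(** The size is a successor so that the square matrices form a nonzero ring; the point [t0] shows
    that [T] is not empty. *)
Let N := #|T|.-1.
Fact card_predK : N.+1 = #|T|.
Proof. by rewrite prednK //; apply/card_gt0P; exists t0. Qed.
Definition index_point (a : 'I_N.+1) : T := enum_val (cast_ord card_predK a).
Definition point_index (t : T) : 'I_N.+1 := cast_ord (esym card_predK) (enum_rank t).

Lemma point_indexK : cancel point_index index_point.
Proof. by move=> t; rewrite /index_point cast_ordKV enum_rankK. Qed.

Lemma index_pointK : cancel index_point point_index.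
Proof. by move=> a; rewrite /point_index enum_valK cast_ordK. Qed.

Definition opmx (g : T -> T -> K) : 'M[K]_N.+1 :=
  \matrix_(a, b) g (index_point a) (index_point b).

Lemma opmxM g h :
  opmx g * opmx h = opmx (fun s t => \sum_r g s r * h r t).
Proof.
apply/matrixP => a b; rewrite !mxE (reindex point_index) /=.
  by apply: eq_bigr => r _; rewrite !mxE point_indexK.
by exists index_point => ? _; rewrite ?point_indexK ?index_pointK.
Qed.
End OperatorMatrix.

Section Creation.
Variables (K : fieldType) (n : nat) (kap : 'I_n -> 'I_n -> K).

(** Matrix of left multiplication by $e_i$ on the exterior algebra of [kap], in the basis of the
    $e_S$. *)
Definition creation (i : 'I_n) :=
  opmx set0 (fun S R : {set 'I_n} => ((i \in S) && (R == S :\ i))%:R * wsign kap i R).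

Lemma creationM i j : i != j ->
  creation i * creation j = opmx set0 (fun S R : {set 'I_n} =>
    ([&& i \in S, j \in S & R == S :\ i :\ j])%:R * (kap j i * wsign kap i R * wsign kap j R)).
Proof.
move=> ij; rewrite opmxM; apply/matrixP => a b.
rewrite !mxE; set S := index_point _ a; set R := index_point _ b.
case iS: (i \in S) => /=; last by rewrite mul0r big1 // => Q _; rewrite !mul0r.
rewrite (bigD1 (S :\ i)) //= eqxx mul1r big1 ?addr0 => [|Q /negPf->]; last first.
  by rewrite !mul0r.
rewrite !inE eq_sym ij /=; case jS: (j \in S) => /=; last by rewrite !mul0r mulr0.
case: eqP => [->|_]; last by rewrite !mul0r mulr0.
rewrite !mul1r (@wsignD1 _ _ _ j) // !inE eq_sym ij; exact: jS.
Qed.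

Lemma creation_swap i j : i != j ->
  kap i j *: (creation i * creation j) = kap j i *: (creation j * creation i).
Proof.
move=> ij; rewrite !creationM // 1?eq_sym //; apply/matrixP => a b; rewrite !mxE.
rewrite andbCA !setDDl [[set i] :|: _]setUC; ring.
Qed.

(** This entry is the coefficient of the image of $e_\emptyset$ on the full set of [l]; a single
    path contributes to it. *)
Lemma prod_creation_neq0 (l : seq 'I_n) : uniq l ->
    {in l &, forall i j, i != j -> kap i j != 0} ->
  (\prod_(i <- l) creation i) (point_index set0 [set i in l]) (point_index set0 set0) != 0.
Proof.
elim: l => [|i l IHl] /=.
  move=> _ _; have -> : [set i in [::]] = set0 :> {set 'I_n}.
    by apply/setP => i; rewrite !inE.
  by rewrite big_nil mxE eqxx oner_eq0.
case/andP=> il ul kap_l; rewrite big_cons mxE.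
have Sl : [set j in i :: l] :\ i = [set j in l].
  apply/setP => j; rewrite !inE; case: eqP => //= ->; exact/esym/negbTE.
rewrite (bigD1 (point_index set0 [set j in l])) //= [X in _ + X]big1 ?addr0 => [|a aS]; last first.
  rewrite [creation i _ _]mxE point_indexK Sl -(can_eq (@point_indexK _ set0)) /=.
  by rewrite index_pointK (negPf aS) andbF !mul0r.
rewrite [creation i _ _]mxE !point_indexK Sl eqxx !inE eqxx mul1r mulf_neq0 //.
  apply/prodf_neq0 => j; rewrite inE => jl.
  by apply: kap_l; rewrite ?inE ?jl ?eqxx ?orbT //; apply: contraNneq il => <-.
by apply: IHl => // j k jl kl; apply: kap_l; rewrite inE ?jl ?kl orbT.
Qed.
End Creation.

Lemma monotone_matching (n : nat) (I J : {set 'I_n}) : #|I| = #|J| ->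
  exists s : 'I_n -> 'I_n,
    {in I &, forall i j : 'I_n, (i < j)%N -> (s i < s j)%N} /\ s @: I = J.
Proof.
(* The k-th element of [I] goes to the k-th element of [J]; outside [I] the default value makes [s]
   the identity. *)
move=> IJ; pose s i := nth i (enum J) (index i (enum I)).
have sorted_enum (L : {set 'I_n}) : sorted (fun a b : 'I_n => (a < b)%N) (enum L).
  rewrite /enum_mem; apply: sorted_filter; first by move=> b a c; apply: ltn_trans.
  rewrite -enumT.
  have : sorted ltn (map val (enum 'I_n)) by rewrite val_enum_ord iota_ltn_sorted.
  by rewrite sorted_map.
have size_IJ : size (enum I) = size (enum J) by rewrite -!cardE.
have s_mono : {in I &, forall i j : 'I_n, (i < j)%N -> (s i < s j)%N}.
  move=> i j iI jI ij.
  have jJ : (index j (enum I) < size (enum J))%N by rewrite -size_IJ index_mem mem_enum.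
  have iJ : (index i (enum I) < size (enum J))%N by rewrite -size_IJ index_mem mem_enum.
  rewrite /s (set_nth_default i j) //; apply: (sorted_ltn_nth _ i (sorted_enum J)) => //.
    by move=> b a c; apply: ltn_trans.
  rewrite ltnNge; apply/negP; rewrite leq_eqVlt => /predU1P[|].
    move=> /(congr1 (nth i (enum I))); rewrite !nth_index ?mem_enum // => ji.
    by rewrite ji ltnn in ij.
  move=> /(sorted_ltn_index _ (sorted_enum I)); rewrite !mem_enum.
  have tr : transitive (fun a b : 'I_n => (a < b)%N) by move=> b a c; apply: ltn_trans.
  by move=> /(_ tr jI iI); rewrite ltnNge ltnW.
exists s; split=> //; apply/eqP; rewrite eqEcard; apply/andP; split.
  apply/subsetP => _ /imsetP[i iI ->].
  by rewrite -mem_enum mem_nth // -size_IJ index_mem mem_enum.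
rewrite card_in_imset ?IJ // => i j iI jI sij; apply/val_inj/eqP.
by case: ltngtP => // /s_mono; rewrite sij ltnn; apply.
Qed.

(** * A representation in which a given minor survives *)

Section Nonvanishing.
Variables (K : fieldType) (n : nat) (p q : 'I_n -> 'I_n -> K) (u : K).
Hypothesis u_neq0 : u != 0.
Hypothesis pq_u2 : forall i j : 'I_n, (i < j)%N -> p i j * q i j = u ^+ 2.
Variables (I J : {set 'I_n}) (s : 'I_n -> 'I_n).
Hypothesis s_mono : {in I &, forall i j : 'I_n, (i < j)%N -> (s i < s j)%N}.
Hypothesis sI : s @: I = J.

(** Chosen so that [creation_swap] becomes the diagonal relation without its cross term, at columns
    [s i] and [s j]. *)
Let kap (i j : 'I_n) : K := if (i < j)%N then (q (s i) (s j))^-1 else (q j i)^-1.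

Definition matching_mx (i j : 'I_n) :=
  if (i \in I) && (j == s i) then creation kap i else 0.

(** Each row and column has at most one nonzero entry, so the row and column relations read 0 = 0.
    As [s] is increasing on [I], products of antidiagonal entries vanish too. *)
Lemma matching_mx_rel : qmx_rel p q u matching_mx.
Proof.
have colN (i k l : 'I_n) : (k < l)%N -> (k == s i) && (l == s i) = false.
  by move=> kl; case: eqP => //= ki; case: eqP => // li; rewrite ki li ltnn in kl.
have anti (i j k l : 'I_n) : (i < j)%N -> (k < l)%N -> i \in I -> j \in I ->
    (l == s i) && (k == s j) = false.
  move=> ij kl iI jI; apply/negP => /andP[/eqP li /eqP kj].
  by have := s_mono iI jI ij; rewrite -li -kj ltnNge ltnW.
have anti0 (i j k l : 'I_n) : (i < j)%N -> (k < l)%N -> 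
    matching_mx i l * matching_mx j k = 0 /\ matching_mx j k * matching_mx i l = 0.
  move=> ij kl; rewrite /matching_mx; have := anti i j k l ij kl.
  case: (i \in I); case: (j \in I); rewrite /= ?mul0r ?mulr0 //.
  by case: (l == s i); case: (k == s j); rewrite ?mul0r ?mulr0 // => /(_ isT isT).
split.
- move=> i k l /(colN i); rewrite /matching_mx; case: (i \in I) => //=; last first.
    by rewrite !mul0r scaler0.
  by case: (k == s i); case: (l == s i); rewrite ?mul0r ?mulr0 ?scaler0.
- move=> i j k ij; rewrite /matching_mx; have := @s_mono i j.
  case: (i \in I) => /=; last by rewrite mul0r mulr0 scaler0.
  case: (j \in I) => /=; last by rewrite mul0r mulr0 scaler0.
  move=> /(_ isT isT ij) sij; case: eqP => [ki|_]; last by rewrite mul0r mulr0 scaler0.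
  case: eqP => [kj|_]; last by rewrite mul0r mulr0 scaler0.
  by rewrite -ki -kj ltnn in sij.
- by move=> i j k l ij kl; have [-> ->] := anti0 _ _ _ _ ij kl; rewrite !scaler0.
move=> i j k l ij kl; have [-> _] := anti0 _ _ _ _ ij kl; rewrite scaler0 addr0.
rewrite /matching_mx; case: andP => [[iI /eqP->]|_]; last by rewrite mul0r mulr0 !scaler0.
case: andP => [[jI /eqP->]|_]; last by rewrite mul0r mulr0 !scaler0.
have ij' : i != j by rewrite -(inj_eq val_inj) ltn_eqF.
by have := creation_swap kap ij'; rewrite /kap ij ltnNge ltnW.
Qed.

(** In row [i] only the column [s i] contributes, so each expansion has a single term. *)
Lemma wprod_matching (l : seq 'I_n) : uniq l -> {subset l <= I} ->
  exists2 c : K, c != 0 & wprod (row_kap q) matching_mx l (s @: [set i in l]) =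
    c *: \prod_(i <- l) creation kap i.
Proof.
have s_inj : {in I &, injective s}.
  move=> i j iI jI sij; apply/val_inj/eqP.
  by case: ltngtP => // /s_mono; rewrite sij ltnn; apply.
elim: l => [|i l IHl] /=.
  exists 1; rewrite ?oner_eq0 // big_nil ffunE scale1r; case: eqP => // /eqP/set0Pn[j].
  by case/imsetP=> k; rewrite inE.
case/andP=> il ul lI; have iI : i \in I by apply: lI; rewrite mem_head.
have [||c c0 IH] := IHl => //; first by move=> j jl; apply: lI; rewrite inE jl orbT.
exists (wsign (row_kap q) (s i) (s @: [set j in l]) * c).
  by rewrite mulf_neq0 // (row_sign_neq0 u_neq0 pq_u2).
have si : s i \in s @: [set j in i :: l] by apply: imset_f; rewrite !inE eqxx.
have Sl : (s @: [set j in i :: l]) :\ s i = s @: [set j in l].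
  apply/setP => j; rewrite in_setD1; apply/andP/imsetP => [[ji /imsetP[k]]|[k]].
    rewrite !inE => /predU1P[-> jE|kl ->]; first by rewrite jE eqxx in ji.
    by exists k; rewrite ?inE.
  rewrite inE => kl ->; split; last by apply: imset_f; rewrite !inE kl orbT.
  apply: contraNneq il => /s_inj <- //; first by apply: lI; rewrite inE kl orbT.
rewrite ffunE (bigD1 (s i)) //= big1 ?addr0 => [|j /andP[_ /negPf ji]]; last first.
  by rewrite /matching_mx ji andbF mul0r scaler0.
by rewrite Sl IH /matching_mx iI eqxx big_cons -scalerAr scalerA.
Qed.

Lemma matching_minor_neq0 : wminor (row_kap q) matching_mx (enum 'I_n) I J != 0.
Proof.
have ul : uniq (filter (mem I) (enum 'I_n)) by rewrite filter_uniq ?enum_uniq.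
have lI : {subset filter (mem I) (enum 'I_n) <= I} by move=> i; rewrite mem_filter => /andP[].
have [c c0] := wprod_matching ul lI; rewrite /wminor.
have -> : [set i in filter (mem I) (enum 'I_n)] = I.
  by apply/setP => i; rewrite inE mem_filter mem_enum andbT.
rewrite sI => ->; rewrite scaler_eq0 negb_or c0 /=.
apply: contraTneq (prod_creation_neq0 ul (kap := kap) _) => [->|]; first by rewrite mxE eqxx.
move=> i j /lI iI /lI jI; rewrite neq_ltn /kap => /orP[ij|ji].
  by rewrite ij invr_eq0 (q_neq0 u_neq0 pq_u2) ?s_mono.
by rewrite ltnNge ltnW //= invr_eq0 (q_neq0 u_neq0 pq_u2).
Qed.

End Nonvanishing.

(** The representation attached to an increasing bijection from [I] to [J] sends this minor to a
    nonzero operator. *)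
Lemma gen_minor_neq0 (K : fieldType) (n : nat) (p q : 'I_n -> 'I_n -> K) (u : K)
    (I J : {set 'I_n}) :
    u != 0 -> (forall i j : 'I_n, (i < j)%N -> p i j * q i j = u ^+ 2) ->
    #|I| = #|J| ->
  wminor (row_kap q) (gen_mx p q u) (enum 'I_n) I J != 0.
Proof.
move=> u_neq0 pq_u2 /monotone_matching[s [s_mono sI]].
have [f fX] := qmx_lift (matching_mx_rel p q u s_mono).
have := matching_minor_neq0 u_neq0 pq_u2 s_mono sI.
rewrite /wminor -(eq_wprod _ _ fX) -(wprod_map f); apply: contra_neq => ->.
exact: raddf0.
Qed.

(** * Transfer to the ring of fractions *)

Lemma gen_mx_rel (K : fieldType) (n : nat) (p q : 'I_n -> 'I_n -> K) (u : K) :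
  qmx_rel p q u (gen_mx p q u).
Proof.
have pi0 r : mx_relator p q u r -> qmx_pi p q u r = 0.
  move=> rel; rewrite -(raddf0 (qmx_pi p q u)); apply: qmx_pi_eq.
  by rewrite subr0; exact: ideal_gen.
have piXX i j k l : qmx_pi p q u (free_gen K i j * free_gen K k l) =
    gen_mx p q u i j * gen_mx p q u k l by rewrite !mxE; exact: qmx_piM.
have piB a b v w : qmx_pi p q u a = v -> qmx_pi p q u b = w ->
  qmx_pi p q u (a - b) = v - w by move=> <- <-; exact: raddfB.
have piZ c a v : qmx_pi p q u a = v -> qmx_pi p q u (c *: a) = c *: v.
  by move=> <-; exact: qmx_pi_scalable.
have piZXX c i j k l := piZ c _ _ (piXX i j k l).
split=> [i k l kl|i j k ij|i j k l ij kl|i j k l ij kl]; apply/eqP; rewrite -subr_eq0.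
- rewrite -(piB _ _ _ _ (piXX _ _ _ _) (piZXX _ _ _ _ _)).
  by apply/eqP/pi0/relator_row.
- rewrite -(piB _ _ _ _ (piXX _ _ _ _) (piZXX _ _ _ _ _)).
  by apply/eqP/pi0/relator_col.
- rewrite -(piB _ _ _ _ (piZXX _ _ _ _ _) (piZXX _ _ _ _ _)).
  by apply/eqP/pi0/relator_antidiag.
rewrite opprD addrA.
rewrite -(piB _ _ _ _ (piB _ _ _ _ (piZXX _ _ _ _ _) (piZXX _ _ _ _ _)) (piZXX _ _ _ _ _)).
by apply/eqP/pi0/relator_diag.
Qed.

Lemma qmx_rel_map (K : fieldType) (n : nat) (p q : 'I_n -> 'I_n -> K) (u : K)
    (A B : algType K) (f : {lrmorphism A -> B}) (X : 'M[A]_n) :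
  qmx_rel p q u X -> qmx_rel p q u (map_mx f X).
Proof.
move=> X_rel; have fXX i j k l : f (X i j * X k l) = map_mx f X i j * map_mx f X k l.
  by rewrite !mxE; exact: rmorphM.
have fZ c a v : f a = v -> f (c *: a) = c *: v by move=> <-; exact: linearZ.
split=> [i k l kl|i j k ij|i j k l ij kl|i j k l ij kl].
- by rewrite -!fXX -(fZ _ _ _ erefl) -(qmx_row X_rel).
- by rewrite -!fXX -(fZ _ _ _ erefl) -(qmx_col X_rel).
- by rewrite -!fXX -!(fZ _ _ _ erefl) (qmx_antidiag X_rel).
rewrite -!fXX -!(fZ _ _ _ erefl) (qmx_diag X_rel) //; exact: raddfD.
Qed.

Local Open Scope complex_scope.

Theorem theorem3p2 (R : realType) (n : nat) (p q : 'I_n -> 'I_n -> R[i])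
    (u : R[i]) (u_neq0 : u != 0) (u2_neqN1 : u ^+ 2 != -1)
    (pq_u2 : forall i j : 'I_n, (i < j)%N -> p i j * q i j = u ^+ 2)
    (D : unitAlgType R[i]) (f : {lrmorphism qmx p q u -> D})
    (f_frac : ring_of_fractions f) :
  let detq := f (qdet q (gen_mx p q u)) in
  let T := map_mx f (gen_mx p q u) in
  [/\ forall (s t : 'S_n) (k : 'I_n), quasiminor_defined T s t k,
      detq = \prod_(k < n) quasiminor T 1%g 1%g k,
      forall k l : 'I_n,
        quasiminor T 1%g 1%g k * quasiminor T 1%g 1%g l
        = quasiminor T 1%g 1%g l * quasiminor T 1%g 1%g k &
      forall s t : 'S_n,
        detq = (qsign q t / qsign q s) *: \prod_(k < n) quasiminor T s t k].
Proof.
move=> detq T; have T_rel : qmx_rel p q u T by exact/qmx_rel_map/gen_mx_rel.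
have minorE I J : f (wminor (row_kap q) (gen_mx p q u) (enum 'I_n) I J) =
    wminor (row_kap q) T (enum 'I_n) I J.
  by rewrite /wminor (wprod_map f) (eq_wprod _ (Y := T)) // => i j; rewrite [RHS]mxE.
(* Nonzero elements become invertible in [D], so it is enough that the minors of the generators do
   not vanish. *)
have T_unit (I J : {set 'I_n}) : #|I| = #|J| ->
    wminor (row_kap q) T (enum 'I_n) I J \is a GRing.unit.
  by move=> IJ; rewrite -minorE; case: f_frac => _ f_unit _; apply/f_unit/gen_minor_neq0.
have detqE : detq = wminor (row_kap q) T (enum 'I_n) setT setT.
  by rewrite /detq qdet_wminor minorE.
have qsign_neq0 (s : 'S_n) : qsign q s != 0.
  rewrite qsignE; apply/prodf_neq0 => i _; exact: row_sign_neq0 u_neq0 pq_u2 _ _.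
have prodE s t := prod_quasiminor u_neq0 pq_u2 T_rel T_unit s t.
split.
- by move=> s t k; case: (quasiminor_row_minor u_neq0 pq_u2 T_rel T_unit s t k).
- by rewrite prodE divff ?scale1r.
- by move=> k l; apply: (quasiminor1_comm u_neq0 pq_u2 T_rel).
move=> s t; rewrite prodE scalerA detqE.
by rewrite mulrA divfK // divff // scale1r.
Qed.
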